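(* The additive group of rational numbers $\mathbb{Q}$ cannot be embedded into a finitely generated metabelian group; that is, there is no injective homomorphism from $\mathbb{Q}$ to any finitely generated metabelian group.
   Context: A group $G$ is metabelian if its derived subgroup $G'=[G,G]$ is abelian (i.e. $G$ is solvable of length at most $2$). *)

(* Defs.v *)
From mathcomp Require Import all_boot all_order all_algebra.
From mathcomp Require Import boolp classical_sets.

Set Implicit Arguments.
Unset Strict Implicit.
Unset Printing Implicit Defensive.

Local Open Scope classical_set_scope.
Local Open Scope group_scope.

(* The groups here may be infinite and their subgroups undecidable, so
   subgroups are [Prop]-valued sets rather than the [{group gT}] of fingroup. *)
Definition is_subgroup (G : groupType) (H : set G) : Prop :=
  [/\ H 1,
      (forall x y, H x -> H y -> H (x * y)) &
      (forall x, H x -> H x^-1)].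

Definition generated (G : groupType) (A : set G) : set G :=
  smallest (@is_subgroup G) A.

Definition finitely_generated (G : groupType) : Prop :=
  exists s : seq G, generated [set` s] = [set: G].

Definition derived_subgroup (G : groupType) : set G :=
  generated [set z | exists x y : G, z = [~ x, y]].

Arguments derived_subgroup : clear implicits.

Definition metabelian (G : groupType) : Prop :=
  forall x y, derived_subgroup G x -> derived_subgroup G y -> commute x y.

(* Main.v *)
(* For a prime p, let a quotient W/N be reduced at p when it has no p-torsion and
   its infinitely p-divisible elements are torsion; this is stable under
   extensions. A module spanned by a finite set over finitely many commuting
   operators is reduced at almost every p (P. Hall): adjoining an operator f to a
   module W gives a module filtered by F_j = W + f W + ... + f^(j-1) W, where
   F_(j+1)/F_j modulo N is W/L_j for an ascending chain of submodules L_j. By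
   noetherianity only finitely many distinct L_j occur, hence only finitely many
   primes are lost, and induction on the number of operators applies.
   If G is generated by s, this covers G/G', and also G', which is spanned by the
   commutators of elements of s under conjugation by s and s^-1. For a p good for
   both, an embedded copy of Q, being p-divisible, has a nonzero element in G',
   together with all its p^k-th roots, so this element is torsion. *)
From HB Require Import structures.
Require Import Defs.
From mathcomp Require Import all_boot all_order all_algebra.
From mathcomp Require Import boolp classical_sets.

Set Implicit Arguments.
Unset Strict Implicit.
Unset Printing Implicit Defensive.

Import Order.TTheory GRing.Theory Num.Theory.
Local Open Scope classical_set_scope.
Local Open Scope ring_scope.

(** * Subgroups of an abelian group and their extensions *)

Definition zsub (V : zmodType) (N : set V) : Prop :=
  N 0 /\ forall x y, N x -> N y -> N (x - y).

Lemma zsubN (V : zmodType) (N : set V) x : zsub N -> N x -> N (- x).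
Proof. by move=> [N0 NB] Nx; rewrite -sub0r; apply: NB. Qed.

Lemma zsubD (V : zmodType) (N : set V) x y : zsub N -> N x -> N y -> N (x + y).
Proof. by move=> sN Nx Ny; rewrite -[y]opprK; apply: sN.2 => //; apply: zsubN. Qed.

Lemma zsubMn (V : zmodType) (N : set V) x n : zsub N -> N x -> N (x *+ n).
Proof.
move=> sN Nx; elim: n => [|n IH]; first by rewrite mulr0n; apply: sN.1.
by rewrite mulrS; apply: zsubD.
Qed.

(* The subgroup [N + F]. *)
Definition modulo (V : zmodType) (N F : set V) : set V :=
  [set x | exists2 y, F y & N (x - y)].

Lemma subrACA (V : zmodType) (x y u v : V) :
  (x - y) - (u - v) = (x - u) - (y - v).
Proof. by rewrite opprD addrACA -opprD. Qed.

Lemma modulo_zsub (V : zmodType) (N F : set V) :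
  zsub N -> zsub F -> zsub (modulo N F).
Proof.
move=> sN sF; split; first by exists 0; [apply: sF.1 | rewrite subr0; apply: sN.1].
move=> x y [u Fu Nu] [v Fv Nv]; exists (u - v); first exact: sF.2.
by rewrite subrACA; apply: sN.2.
Qed.

(* The subgroup [phi(C) + F]. *)
Definition extend (U V : zmodType) (phi : U -> V) (C : set U) (F : set V) : set V :=
  [set x | exists2 c, C c & F (x - phi c)].

Lemma extend_zsub (U V : zmodType) (phi : {additive U -> V}) (C : set U) (F : set V) :
  zsub C -> zsub F -> zsub (extend phi C F).
Proof.
move=> sC sF; split.
  by exists 0; [apply: sC.1 | rewrite raddf0 subr0; apply: sF.1].
move=> x y [u Cu Fu] [v Cv Fv]; exists (u - v); first exact: sC.2.
by rewrite raddfB subrACA; apply: sF.2.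
Qed.

Lemma preim_zsub (U V : zmodType) (phi : {additive U -> V}) (N : set V) :
  zsub N -> zsub [set c | N (phi c)].
Proof.
move=> sN; split=> [|x y Nx Ny] /=; first by rewrite raddf0; apply: sN.1.
by rewrite raddfB; apply: sN.2.
Qed.

(* Modularity argument: a chain is stationary on [extend phi C F] as soon as it is
   on [F] and its image is on [C]. *)
Lemma extend_incl (U V : zmodType) (phi : {additive U -> V}) (C : set U)
    (F N1 N2 : set V) :
  zsub F -> zsub N1 -> zsub N2 -> N1 `<=` N2 ->
  (forall c, C c -> modulo N2 F (phi c) -> modulo N1 F (phi c)) ->
  (forall x, F x -> N2 x -> N1 x) ->
  forall x, extend phi C F x -> N2 x -> N1 x.
Proof.
move=> sF s1 s2 s12 HC HF x [c Cc Fx] N2x.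
have [|y Fy Ny] := HC c Cc.
  by exists (phi c - x); [rewrite -opprB; apply: zsubN | rewrite subKr].
rewrite -[x](subrK (phi c - y)); apply: zsubD => //; apply: HF.
  by rewrite opprB addrCA addrC; apply: zsubD.
by apply: s2.2 => //; apply: s12.
Qed.

(** * Reducedness at a prime, and its stability under extensions *)

Definition reduced_mod (V : zmodType) (p : nat) (W N : set V) : Prop :=
  (forall x, W x -> N (x *+ p) -> N x) /\
  (forall x, W x -> (forall k, exists2 y, W y & N (x - y *+ p ^ k)) ->
     exists2 m, (0 < m)%N & N (x *+ m)).

Lemma reduced_mod_exp (V : zmodType) (p : nat) (W N : set V) k x :
  zsub W -> reduced_mod p W N -> W x -> N (x *+ p ^ k) -> N x.
Proof.
move=> sW [tf _] Wx; elim: k => [|k IH] /=; first by rewrite mulr1n.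
by rewrite expnSr mulrnA => H; apply/IH/tf => //; apply: zsubMn.
Qed.

(** If p x lies in [N2], then [phi (c *+ p)] lies in [N2] + [F], hence [phi c] lies in [N1] + [F];
    removing its [N1]-part from x leaves an element of [F]. *)
Lemma extend_torsion (U V : zmodType) (phi : {additive U -> V}) p (C : set U)
    (F N1 N2 : set V) :
  zsub F -> zsub N1 -> zsub N2 -> N1 `<=` N2 ->
  (forall c, C c -> modulo N2 F (phi (c *+ p)) -> modulo N1 F (phi c)) ->
  (forall x, F x -> N2 (x *+ p) -> N1 x) ->
  forall x, extend phi C F x -> N2 (x *+ p) -> N1 x.
Proof.
move=> sF s1 s2 s12 HC HF x [c Cc Fx] N2x.
have [|y Fy Ny] := HC c Cc.
  exists (phi (c *+ p) - x *+ p); last by rewrite subKr.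
  by rewrite raddfMn -mulrnBl -opprB mulNrn; apply: zsubN => //; apply: zsubMn.
rewrite -[x](subrK (phi c - y)); apply: zsubD => //; apply: HF.
  by rewrite opprB addrCA addrC; apply: zsubD.
by rewrite mulrnBl; apply: s2.2 => //; apply: zsubMn => //; apply: s12.
Qed.

(** A multiple of x killed in the upper layer falls into [F] modulo [N]. The same multiple of each
    root of x follows it there, since the upper layer has no p-torsion, so divisibility passes to
    [F]. *)
Lemma extend_reduced (U V : zmodType) (phi : {additive U -> V}) p (C : set U)
    (F N : set V) :
  zsub C -> zsub F -> zsub N ->
  reduced_mod p C [set c | modulo N F (phi c)] -> reduced_mod p F N ->
  reduced_mod p (extend phi C F) N.
Proof.
move=> sC sF sN redC redF.
have sL := preim_zsub phi (modulo_zsub sN sF).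
split; first by apply: extend_torsion => //; [exact: redC.1 | exact: redF.1].
move=> x [c Cc Fx] divx.
have div_c k : exists2 b : U * V, C b.1 /\ F (b.2 - phi b.1) &
    N (x - b.2 *+ p ^ k) /\ modulo N F (phi (c - b.1 *+ p ^ k)).
  have [y [d Cd Fy] Nxy] := divx k; exists (d, y) => //=; split => //.
  exists (phi (c - d *+ p ^ k) - (x - y *+ p ^ k)); last by rewrite subKr.
  rewrite raddfB raddfMn subrACA -mulrnBl; apply: sF.2.
    by rewrite -opprB; apply: zsubN.
  by apply: zsubMn => //; rewrite -opprB; apply: zsubN.
have [|m m_gt0 [w Fw Nw]] := redC.2 c Cc.
  by move=> k; have [b [Cb _] [_ Lb]] := div_c k; exists b.1.
have shiftF z d v : F (z - phi d) -> F v -> F (z *+ m - (phi (d *+ m) - v)).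
  move=> Fz Fv; rewrite opprB addrCA raddfMn -mulrnBl.
  by apply: zsubD => //; apply: zsubMn.
have [||n n_gt0 Nn] := redF.2 (x *+ m - (phi (c *+ m) - w)); first exact: shiftF.
  move=> k; have [[d y] /= [Cd Fy] [Nxy Ld]] := div_c k.
  (* p^k (m d) is m c minus m (c - p^k d), both in the preimage of [N] + [F]; absence of p-torsion
     removes p^k. *)
  have : modulo N F (phi (d *+ m)).
    apply: (@reduced_mod_exp _ p C _ k _ sC redC); first exact: zsubMn.
    rewrite /= -mulrnA mulnC mulrnA -[d *+ _](subKr c) mulrnBl.
    apply: (sL.2 (c *+ m)); first by exists w.
    exact: (zsubMn (N := [set c | modulo N F (phi c)])).
  move=> [v Fv Nv]; exists (y *+ m - (phi (d *+ m) - v)); first exact: shiftF.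
  rewrite mulrnBl subrACA mulrnAC -mulrnBl; apply: sN.2; first exact: zsubMn.
  by apply: sN.2 => //; apply: zsubMn.
exists (m * n)%N; first by rewrite muln_gt0 m_gt0.
rewrite mulrnA -[x *+ m](subrK (phi (c *+ m) - w)) mulrnDl.
by apply: zsubD => //; apply: zsubMn.
Qed.

(** * Chain condition and almost reducedness, with the case of no operators *)

Definition stable (V : zmodType) (T : nat -> {additive V -> V}) n (N : set V) : Prop :=
  zsub N /\ forall i x, (i < n)%N -> N x -> N (T i x).

(** Chains live in the whole of [V] and are compared only on [W]; this admits chains of leading
    modules, which need not lie in [W]. *)
Definition acc_on (V : zmodType) (T : nat -> {additive V -> V}) n (W : set V) : Prop :=
  forall K : nat -> set V, (forall i, stable T n (K i)) ->
    (forall i, K i `<=` K i.+1) ->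
  exists m, forall i x, W x -> K i x -> K m x.

Definition almost_reduced (V : zmodType) (T : nat -> {additive V -> V}) n
    (W : set V) : Prop :=
  forall N, stable T n N -> exists B, forall p, (B < p)%N -> prime p ->
    reduced_mod p W N.

Lemma chain_le (V : Type) (K : nat -> set V) :
  (forall i, K i `<=` K i.+1) -> forall i j, (i <= j)%N -> K i `<=` K j.
Proof.
move=> HK i j /subnK <-; elim: (j - i)%N => [//|k IH] x /IH.
by rewrite addSn; apply: HK.
Qed.

Lemma zsub_mulz (N : set int) (x y : int) : zsub N -> N x -> N (x * y).
Proof.
move=> sN Nx; case: (intP y) => [|n|n]; first by rewrite mulr0; apply: sN.1.
  by rewrite -natz mulr_natr; apply: zsubMn.
by rewrite mulrN -natz mulr_natr; apply: zsubN => //; apply: zsubMn.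
Qed.

(** The least positive integer g found in any term generates the union, since a nonzero remainder
    modulo g would be smaller. The chain stops once g has appeared. *)
Lemma int_acc (K : nat -> set int) :
  (forall i, zsub (K i)) -> (forall i, K i `<=` K i.+1) ->
  exists m, forall i, K i `<=` K m.
Proof.
move=> sK HK.
have [[[i x] /= Kx x_neq0]|noK] := pselect (exists2 b : nat * int, K b.1 b.2 & b.2 != 0);
    last first.
  exists 0%N => i x Kx; have [->|x0] := eqVneq x 0; first exact: (sK 0%N).1.
  by case: noK; exists (i, x).
have exg : exists n, `[< (0 < n)%N /\ exists j, K j n%:Z >].
  exists `|x|%N; apply/asboolP; rewrite absz_gt0; split=> //; exists i.
  by rewrite abszE normrEsg mulrC; apply: zsub_mulz.
have [g /asboolP[g_gt0 [m Kg]] min_g] := find_ex_minn exg.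
exists m => j y Ky.
pose l := maxn m j.
have Kl : K l (y %% g%:Z)%Z.
  rewrite /modz mulrC; apply: (sK l).2; first exact: (chain_le HK (leq_maxr m j)).
  by apply: zsub_mulz => //; apply: (chain_le HK (leq_maxl m j)).
have g_neq0 : g%:Z != 0 by rewrite -lt0n.
have : ((y %% g%:Z)%Z < g%:Z) by rewrite ltz_pmod.
have : (0 <= (y %% g%:Z)%Z) by rewrite modz_ge0.
move: Kl (divz_eq y g); case: (y %% g%:Z)%Z => // r Kr -> _; rewrite ltz_nat => r_lt.
case: (posnP r) => [->|r_gt0].
  by rewrite addr0 mulrC; apply: zsub_mulz.
have /min_g : `[< (0 < r)%N /\ exists j, K j r%:Z >].
  by apply/asboolP; split=> //; exists l.
by rewrite leqNgt r_lt.
Qed.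

(** If [N] contains a nonzero c, then |c| kills the quotient and every prime p > |c| is coprime to
    c. If [N] is zero, only 0 is divisible by all powers of p. *)
Lemma int_almost_reduced (N : set int) :
  zsub N -> exists B, forall p, (B < p)%N -> prime p -> reduced_mod p setT N.
Proof.
move=> sN; have [[c Nc c_neq0]|N0] := pselect (exists2 c, N c & c != 0).
  exists `|c|%N => p ltcp p_pr; split=> [x _ Npx|x _ _]; last first.
    exists `|c|%N; first by rewrite absz_gt0.
    by rewrite -mulr_natr natz abszE normrEsg mulrA mulrC; apply: zsub_mulz.
  have [[u v] /= cop] : exists uv : int * int, uv.1 * c + uv.2 * p%:Z = 1.
    have /coprimezP[[u v] /= Huv] : coprimez c p.
      rewrite coprimezE /= coprime_sym prime_coprime // gtnNdvd ?absz_gt0 //.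
    by exists (u, v).
  rewrite -[x]mulr1 -cop mulrDr; apply: zsubD => //.
    by rewrite mulrA mulrC; apply: zsub_mulz.
  by rewrite mulrCA mulrC -natz mulr_natr; apply: zsub_mulz.
have {}N0 x : N x -> x = 0.
  by move=> Nx; have [//|x0] := eqVneq x 0; case: N0; exists x.
exists 0%N => p p0 p_pr; split=> [x _ /N0 /eqP|x _ divx].
  rewrite -mulr_natr mulf_eq0 natz -[_%:Z == 0]/(p == 0%N) [p == _]gtn_eqF ?orbF //.
  by move=> /eqP ->; apply: sN.1.
exists 1%N => //; suff -> : x = 0 by rewrite mul0rn; apply: sN.1.
(* The exponent |x| is enough, since p^|x| > |x|. *)
have [y _ /N0 /eqP] := divx `|x|%N; rewrite subr_eq0 => /eqP xE.
have : (p ^ `|x| %| `|x|)%N.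
  by rewrite [X in (_ %| X)%N](congr1 absz xE) -mulr_natr abszM natz dvdn_mull.
case: (posnP `|x|) => [/eqP|x_gt0]; first by rewrite absz_eq0 => /eqP.
by move/(dvdn_leq x_gt0); rewrite leqNgt ltn_expl ?prime_gt1.
Qed.

Lemma extend0 (U V : zmodType) (phi : {additive U -> V}) C (F : set V) :
  zsub C -> F `<=` extend phi C F.
Proof. by move=> sC x Fx; exists 0; [apply: sC.1 | rewrite raddf0 subr0]. Qed.

(** Generators are added one at a time, each step being an extension by the image of Z under n |-> n
    s. *)
Lemma tame_base (V : zmodType) (T : nat -> {additive V -> V}) (S : seq V) :
  exists W, [/\ [set` S] `<=` W, stable T 0 W, acc_on T 0 W & almost_reduced T 0 W].
Proof.
elim: S => [|s S [W [SW [sW _] accW redW]]].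
  have s0 : zsub [set (0 : V)] by split=> // x y -> ->; rewrite subrr.
  exists [set 0]; split=> [x|||] //.
  - by move=> K sK _; exists 0%N => _ x -> _; apply: (sK 0%N).1.1.
  - move=> N sN; exists 0%N => p _ _; split=> x -> //; first by move=> _; apply: sN.1.1.
    by move=> _; exists 1%N => //; apply: sN.1.1.
pose phi : {additive int -> V} := ( *~%R s).
have sZ : zsub [set: int] by [].
have sX := extend_zsub phi sZ sW.
exists (extend phi setT W); split=> //.
- move=> x; rewrite /= inE => /orP[/eqP ->|/SW Wx]; last exact: extend0.
  by exists 1 => //=; rewrite mulr1z subrr; apply: sW.1.
- move=> K sK HK.
  have [m1 Hm1] := @int_acc (fun i => [set c | modulo (K i) W (phi c)])
    (fun i => preim_zsub phi (modulo_zsub (sK i).1 sW))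
    (fun i c => fun '(ex_intro2 y Wy Ky) => ex_intro2 _ _ y Wy (HK i _ Ky)).
  have [m2 Hm2] := accW K sK HK.
  exists (maxn m1 m2) => i x Xx Kx.
  pose l := maxn (maxn m1 m2) i.
  have le_m1 := chain_le HK (leq_maxl m1 m2).
  have le_m2 := chain_le HK (leq_maxr m1 m2).
  apply: (@extend_incl _ _ phi setT W (K (maxn m1 m2)) (K l)) => //.
  + exact: (sK _).1.
  + exact: (sK _).1.
  + exact: (chain_le HK (leq_maxl _ i)).
  + by move=> c _ /(Hm1 l)[y Wy Ky]; exists y => //; apply: le_m1.
  + by move=> y Wy Ky; apply/le_m2/(Hm2 l).
  + exact: (chain_le HK (leq_maxr _ i)).
- move=> N sN; have [B1 H1] := redW N sN.
  have [B2 H2] := int_almost_reduced (preim_zsub phi (modulo_zsub sN.1 sW)).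
  exists (maxn B1 B2) => p; rewrite gtn_max => /andP[ltB1 ltB2] p_pr.
  by apply: extend_reduced => //; [exact: sN.1 | exact: H2 | exact: H1].
Qed.

(** * Adjoining one operator to a module *)

Definition iterate (V : zmodType) (f : {additive V -> V}) (j : nat) (x : V) := iter j f x.

Lemma iterate_is_additive (V : zmodType) (f : {additive V -> V}) j :
  zmod_morphism (iterate f j).
Proof. by rewrite /iterate => x y; elim: j => //= j ->; rewrite raddfB. Qed.

HB.instance Definition _ (V : zmodType) (f : {additive V -> V}) j :=
  GRing.isZmodMorphism.Build V V (iterate f j) (iterate_is_additive f j).

Fixpoint orbit_sum (V : zmodType) (f : {additive V -> V}) (W : set V) (j : nat) : set V :=
  if j is i.+1 then extend (iterate f i) W (orbit_sum f W i) else [set 0].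

Lemma eventually_uniform (P : nat -> nat -> Prop) n :
  (forall j, exists m, forall k, (m <= k)%N -> P j k) ->
  exists m, forall j k, (j < n)%N -> (m <= k)%N -> P j k.
Proof.
move=> HP; elim: n => [|n [m Hm]]; first by exists 0%N.
have [m' Hm'] := HP n; exists (maxn m m') => j k.
rewrite ltnS geq_max leq_eqVlt => /orP[/eqP ->|ltj] /andP[le le'].
  exact: Hm'.
exact: Hm.
Qed.

Section AdjoinOperator.
Variables (V : zmodType) (T : nat -> {additive V -> V}) (n : nat) (W : set V).
Hypothesis TC : forall i j x, T i (T j x) = T j (T i x).
Hypothesis stW : stable T n W.

Let f := T n.
Let Fil := orbit_sum f W.

Lemma iterateC i j x : T i (iterate f j x) = iterate f j (T i x).
Proof. by rewrite /iterate; elim: j => //= j IH; rewrite TC IH. Qed.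

Lemma orbit_sum_zsub j : zsub (Fil j).
Proof.
elim: j => [|j IH]; last exact: extend_zsub stW.1 IH.
by split=> // x y -> ->; rewrite subrr.
Qed.

Lemma orbit_sum_stable j : stable T n (Fil j).
Proof.
split; first exact: orbit_sum_zsub.
elim: j => [|j IH] i x ltin; first by move=> ->; rewrite raddf0.
move=> [v Wv Fv]; exists (T i v); first exact: stW.2.
by rewrite -iterateC -raddfB; apply: IH.
Qed.

Lemma orbit_sum_shift j x : Fil j x -> Fil j.+1 (f x).
Proof.
elim: j x => [|j IH] x /=.
  by move=> ->; exists 0; [apply: stW.1.1 | rewrite /iterate /= raddf0 subrr].
by move=> [v Wv /IH]; rewrite raddfB => H; exists v.
Qed.

Lemma orbit_sumS j : Fil j `<=` Fil j.+1.
Proof. exact: extend0 stW.1. Qed.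

(** The L_j, as in Hilbert's basis theorem: leading coefficients v of polynomials f^j v + lower
    terms over [W] with value in [N]. *)
Definition lead (N : set V) j : set V := [set v | modulo N (Fil j) (iterate f j v)].

Lemma lead_stable N j : stable T n.+1 N -> stable T n (lead N j).
Proof.
move=> [sN stN]; split.
  exact: preim_zsub (modulo_zsub sN (orbit_sum_zsub j)).
move=> i x ltin [y Fy Ny]; exists (T i y); first exact: (orbit_sum_stable j).2.
by rewrite -iterateC -raddfB; apply: stN => //; apply: ltnW.
Qed.

(** Applying [f] raises the degree and keeps the leading coefficient. *)
Lemma leadS N j : stable T n.+1 N -> lead N j `<=` lead N j.+1.
Proof.
move=> [sN stN] x [y Fy Ny]; exists (f y); first exact: orbit_sum_shift.
by rewrite /iterate iterS -raddfB; apply: stN.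
Qed.

Lemma lead_le N j k : stable T n.+1 N -> (j <= k)%N -> lead N j `<=` lead N k.
Proof. by move=> stN; apply: (chain_le (K := lead N)) => i; apply: leadS. Qed.

Lemma leadW N N' j : N `<=` N' -> lead N j `<=` lead N' j.
Proof. by move=> NN' x [y Fy Ny]; exists y => //; apply: NN'. Qed.

Definition orbit_span : set V := [set x | exists j, Fil j x].

Lemma orbit_sum_le i j : (i <= j)%N -> Fil i `<=` Fil j.
Proof. by apply: chain_le => k; apply: orbit_sumS. Qed.

Lemma orbit_span_stable : stable T n.+1 orbit_span.
Proof.
split; first split; first by exists 0%N.
  move=> x y [i Fx] [j Fy]; exists (maxn i j); apply: (orbit_sum_zsub _).2.
    exact: orbit_sum_le (leq_maxl i j) _ Fx.
  exact: orbit_sum_le (leq_maxr i j) _ Fy.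
move=> i x; rewrite ltnS leq_eqVlt => /orP[/eqP ->|ltin] [j Fx].
  by exists j.+1; apply: orbit_sum_shift.
by exists j; apply: (orbit_sum_stable j).2.
Qed.

Lemma orbit_span_sub : W `<=` orbit_span.
Proof. by move=> x Wx; exists 1%N; exists x; rewrite //= /iterate /= subrr. Qed.

(** Hilbert's basis argument: two nested terms agree on [orbit_span] as soon as their leading
    modules agree on [W] in every degree. *)
Lemma orbit_span_acc : acc_on T n W -> acc_on T n.+1 orbit_span.
Proof.
move=> accW K stK HK.
have KW i j : (i <= j)%N -> K i `<=` K j by apply: chain_le.
have [m0 Hm0] := accW (fun i => lead (K i) i)
  (fun i => lead_stable i (stK i))
  (fun i => subset_trans (leadW (j := i) (HK i)) (leadS (j := i) (stK i.+1))).
(* Below degree [m0] there are finitely many chains of leading modules, one per degree. *)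
have [m1 Hm1] : exists m, forall j k, (j < m0)%N -> (m <= k)%N ->
    forall i v, W v -> lead (K i) j v -> lead (K k) j v.
  apply: eventually_uniform => j.
  have [m Hm] := accW (fun i => lead (K i) j) (fun i => lead_stable j (stK i))
    (fun i => leadW (j := j) (HK i)).
  by exists m => k lemk i v Wv /(Hm _ _ Wv); apply/leadW/KW.
(* The diagonal chain [lead (K i) i] bounds all leading modules of index [j >= m0]. *)
pose m := maxn m0 m1; exists m => i x [j Fx] Kx.
have {}Kx : K (maxn m i) x by apply: (KW i) Kx; rewrite leq_maxr.
move: Fx Kx; set l := maxn m i; have leml : (m <= l)%N by rewrite leq_maxl.
elim: j x => [|j IH] x; first by move=> -> _; apply: (stK _).1.1.
apply: extend_incl => //; first exact: orbit_sum_zsub.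
- exact: (stK _).1.
- exact: (stK _).1.
- exact: KW.
move=> c Wc Lc; have [ltj|lej] := ltnP j m0.
  by apply: (Hm1 j m ltj (leq_maxr _ _) l).
apply: (leadW (KW m0 m (leq_maxl _ _)) (j := j)).
apply: (lead_le (stK m0) lej); apply: (Hm0 (maxn j l)) => //.
apply: (lead_le (stK _) (leq_maxl j l)).
exact: (leadW (KW _ _ (leq_maxr j l))) Lc.
Qed.

(** The layers are images of [W] modulo [lead N j], which is constant on [W] from some degree on, so
    one bound on p serves all layers and hence every [Fil j]. For the union, roots must also be
    brought back to a fixed [Fil i]. *)
Lemma orbit_span_almost_reduced :
  acc_on T n W -> almost_reduced T n W -> almost_reduced T n.+1 orbit_span.
Proof.
move=> accW redW N stN; have sN := stN.1.
have [m0 Hm0] := accW (lead N) (fun i => lead_stable i stN) (fun i => leadS (j := i) stN).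
(* Degree [m0] is included: it stands for all higher degrees. *)
have [B HB] : exists B, forall j p, (j < m0.+1)%N -> (B <= p)%N -> prime p ->
    reduced_mod p W (lead N j).
  apply: eventually_uniform => j; have [B HB] := redW _ (lead_stable j stN).
  by exists B.+1 => p; apply: HB.
exists B => p ltBp p_pr.
have redL j : reduced_mod p W (lead N j).
  have [lej|ltj] := leqP j m0; first by apply: HB => //; apply: ltnW.
  have [tf dv] := HB m0 p (ltnSn _) (ltnW ltBp) p_pr.
  have le0j := lead_le stN (ltnW ltj).
  split=> [x Wx Lx|x Wx divx].
    by apply/le0j/tf => //; apply: (Hm0 j) => //; apply: zsubMn stW.1 _.
  have [k|d d_gt0 Ld] := dv x Wx; last by exists d => //; apply: le0j.
  have [y Wy Ly] := divx k; exists y => //; apply: (Hm0 j) => //.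
  by apply: stW.1.2 => //; apply: zsubMn stW.1 _.
have redF j : reduced_mod p (Fil j) N.
  elim: j => [|j IH]; last first.
    exact: (extend_reduced (phi := iterate f j) stW.1 (orbit_sum_zsub j) sN (redL j) IH).
  split=> x ->; first by move=> _; apply: sN.1.
  by move=> _; exists 1%N => //; apply: sN.1.
(* Modulo [N], the quotient of [Fil (k + i)] by [Fil i] has no p-torsion, because its layers have
   none. *)
have torsion i k x : Fil (k + i)%N x -> modulo N (Fil i) (x *+ p) -> modulo N (Fil i) x.
  have smod := modulo_zsub sN (orbit_sum_zsub i).
  elim: k x => [|k IH] x; first by move=> Fx _; exists x; rewrite // subrr; apply: sN.1.
  have Fiki : Fil i `<=` Fil (k + i)%N by apply: orbit_sum_le; rewrite leq_addl.
  apply: extend_torsion => //; first exact: orbit_sum_zsub.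
  move=> c Wc [y Fy [z Fz Nyz]].
  have [|w Fw Nw] := (redL (k + i)%N).1 c Wc.
    exists (y + z); first by apply: zsubD (orbit_sum_zsub _) Fy _; apply: Fiki.
    by rewrite opprD addrA.
  by exists w => //; exists 0; [apply: (orbit_sum_zsub i).1 | rewrite subr0].
have torsionX i k j x : Fil j x -> modulo N (Fil i) (x *+ p ^ k) -> modulo N (Fil i) x.
  move=> Fx; elim: k => [|k IH]; first by rewrite mulr1n.
  rewrite expnSr mulrnA => H; apply: IH; apply: (torsion i j) H.
  by apply: zsubMn (orbit_sum_zsub _) _; apply: orbit_sum_le Fx; rewrite leq_addr.
split=> [x [j Fx]|x [i Fx] divx]; first exact: (redF j).1.
(* The root y may lie in a higher [Fil j]; [torsionX] replaces it by z in [Fil i], equal to y modulo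
   [N]. *)
apply: ((redF i).2 x Fx) => k; have [y [j Fy] Ny] := divx k.
have [|z Fz Nz] := torsionX i k j y Fy.
  exists x => //; rewrite -opprB; exact: zsubN.
exists z => //; rewrite -(subrK (y *+ p ^ k) x) -addrA -mulrnBl.
by apply: zsubD => //; apply: zsubMn.
Qed.

End AdjoinOperator.

(** Induction on the number of operators. The chain condition is carried along because it bounds the
    lost primes at the next operator. *)
Lemma tame_span (V : zmodType) (T : nat -> {additive V -> V}) (n : nat) (S : seq V) :
  (forall i j x, T i (T j x) = T j (T i x)) ->
  exists W, [/\ [set` S] `<=` W, stable T n W, acc_on T n W & almost_reduced T n W].
Proof.
move=> TC; elim: n => [|n [W [SW stW accW redW]]]; first exact: tame_base.
exists (orbit_span T n W); split.
- exact: subset_trans SW (@orbit_span_sub V T n W).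
- exact: orbit_span_stable.
- exact: orbit_span_acc.
- exact: orbit_span_almost_reduced.
Qed.

(** * Commutators and abelian subquotients of a group *)

Local Open Scope group_scope.

Lemma generated_subgroup (G : groupType) (A : set G) : is_subgroup (generated A).
Proof.
split=> [B [[] //]|x y Ax Ay B HB|x Ax B HB].
  by case: (HB) => -[_ BM _] _; apply: BM; [apply: Ax | apply: Ay].
by case: (HB) => -[_ _ BV] _; apply: BV; apply: Ax.
Qed.

Lemma subgroup_eqT (G : groupType) (s : seq G) (A : set G) :
  generated [set` s] = setT -> is_subgroup A -> {subset s <= A} -> forall x, A x.
Proof.
move=> gens sA sub x; have : generated [set` s] x by rewrite gens.
by apply: smallest_sub => // y /sub; rewrite inE.
Qed.

Lemma derived_commg (G : groupType) (x y : G) : derived_subgroup G [~ x, y].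
Proof. by apply: sub_gen_smallest; exists x, y. Qed.

Lemma derived_sub (G : groupType) (Y : set G) :
  is_subgroup Y -> (forall x y, Y [~ x, y]) -> derived_subgroup G `<=` Y.
Proof. by move=> sY HY; apply: smallest_sub => // z [x [y ->]]. Qed.

Lemma commMg_conj (G : groupType) (x y z : G) : [~ x * y, z] = [~ x, z] ^ y * [~ y, z].
Proof. by rewrite !commgEr conjgM mulgA -conjMg mulgK. Qed.

Lemma commgM_conj (G : groupType) (x y z : G) : [~ x, y * z] = [~ x, z] * [~ x, y] ^ z.
Proof. by rewrite !commgEl conjgM -mulgA (conjMg x^-1) conjVg mulVKg. Qed.

(** Commutator identities reduce [x, y] to conjugates of commutators of generators, first in y, then
    in x. Both g and its inverse are listed since conjugation by g could map an infinite [Y]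
    properly into itself. *)
Lemma derived_sub_conj_closed (G : groupType) (s : seq G) (Y : set G) :
  generated [set` s] = setT -> is_subgroup Y ->
  (forall g x, g \in s -> Y x -> Y (x ^ g) /\ Y (x ^ g^-1)) ->
  (forall g h, g \in s -> h \in s -> Y [~ g, h]) -> derived_subgroup G `<=` Y.
Proof.
move=> gens sY Yconj Ycomm; have [Y1 YM YV] := sY.
have {}Yconj g : forall x, Y x -> Y (x ^ g) /\ Y (x ^ g^-1).
  apply: (subgroup_eqT (A := [set g | forall x, Y x -> Y (x ^ g) /\ Y (x ^ g^-1)]) gens).
    split=> [x Yx|a b Ha Hb x Yx|a Ha x Yx]; first by rewrite invg1 conjg1.
      rewrite invgM !conjgM; split; first by apply: (Hb _ _).1; apply: (Ha _ _).1.
      by apply: (Ha _ _).2; apply: (Hb _ _).2.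
    by rewrite invgK; have [] := Ha x Yx.
  by move=> a sa; rewrite inE /= => x; apply: Yconj.
apply: derived_sub => // x y; move: x.
apply: (subgroup_eqT (A := [set y | forall x, Y [~ x, y]]) gens).
  split=> [x|a b Ha Hb x|a Ha x]; first by rewrite commg1.
    by rewrite commgM_conj; apply: YM => //; apply: (Yconj _ _ _).1.
  (* Expanding [x, a a^-1] = 1 makes [x, a^-1] the inverse of a conjugate of [x, a]. *)
  have := commgM_conj x a a^-1; rewrite mulgV commg1 => /esym/mulg1_eq E.
  by rewrite -[[~ x, _]]invgK E; apply/YV; apply: (Yconj _ _ _).1.
move=> a sa; rewrite inE /= => x.
apply: (subgroup_eqT (A := [set x | Y [~ x, a]]) gens) x.
  split=> [|b c Hb Hc|b Hb] /=; first by rewrite comm1g.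
    by rewrite commMg_conj; apply: YM => //; apply: (Yconj _ _ _).1.
  have := commMg_conj b b^-1 a; rewrite mulgV comm1g => /esym/mulg1_eq <-.
  by apply/YV; apply: (Yconj _ _ _).1.
by move=> b sb; rewrite inE /=; apply: Ycomm.
Qed.

(** H/K is realised on chosen coset representatives: [phi] takes the class and [rho] reads off the
    representative. It serves for G over G' and for G' over 1. *)
Lemma abelian_subquotient (G : groupType) (H K : set G) :
  is_subgroup H -> is_subgroup K -> K `<=` H ->
  (forall x y, H x -> H y -> K [~ x, y]) ->
  exists (V : zmodType) (phi : G -> V) (rho : V -> G),
    [/\ forall v, H (rho v), cancel rho phi,
        forall x y, H x -> H y -> phi (x * y) = (phi x + phi y)%R &
        forall x, H x -> (phi x = 0%R <-> K x)].
Proof.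
move=> [H1 HM HV] [K1 KM KV] KH Kcomm.
have Kconj k x : K k -> H x -> K (k ^ x).
  by move=> Kk Hx; rewrite -[k ^ x](mulVKg k) -commgEl; apply: KM => //;
     apply/Kcomm => //; apply: KH.
pose cong x y := K (x / y).
have congV x y : cong x y -> cong y x by move=> /KV; rewrite /cong invgF.
have congT y x z : cong x y -> cong y z -> cong x z.
  by move=> /KM H2 /H2; rewrite /cong mulgA mulgVK.
have congM x x' y y' : H x -> cong x x' -> cong y y' -> cong (x * y) (x' * y').
  move=> Hx Kx Ky; have := KM _ _ (Kconj _ _ Ky (HV _ Hx)) Kx.
  by rewrite /cong conjgE invgK invgM !mulgA mulgVK.
(* Congruent elements have the same candidates and the same default 1, so the choice depends only on
   the coset. *)
pose r x := xget 1 [set y | H y /\ cong x y].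
have rP x : H x -> H (r x) /\ cong x (r x).
  by move=> Hx; apply: (@xgetPex _ 1 [set y | H y /\ cong x y]); exists x;
     split=> //; rewrite /cong mulgV.
have rE x y : cong x y -> r x = r y.
  move=> cxy; congr (xget 1 _); apply/seteqP; split=> z [Hz cz]; split=> //.
    by apply: congT (congV _ _ cxy) cz.
  exact: congT cxy cz.
have rK x : H x -> r (r x) = r x by move=> /rP[_ /rE].
pose W := {x : G | `[< H x /\ r x = x >]}.
have pi_ok x : H x -> `[< H (r x) /\ r (r x) = r x >].
  by move=> Hx; apply/asboolP; split; [have [] := rP x Hx | apply: rK].
pose pi0 : W := exist _ (r 1) (pi_ok 1 H1).
pose pi x : W := insubd pi0 (r x).
have valpi x : H x -> val (pi x) = r x.
  by move=> Hx; rewrite /pi insubdK; last exact: (pi_ok x Hx).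
have valH (w : W) : H (val w) by have /asboolP[] := valP w.
have valK (w : W) : pi (val w) = w.
  by apply: val_inj; rewrite valpi //; have /asboolP[] := valP w.
have piE x y : cong x y -> pi x = pi y by move=> cxy; rewrite /pi (rE x y cxy).
have pi_cong x : H x -> cong x (val (pi x)).
  by move=> Hx; rewrite valpi //; have [] := rP x Hx.
have piM x y : H x -> H y -> pi (x * y) = pi (val (pi x) * val (pi y)).
  by move=> Hx Hy; apply/piE/congM => //; apply: pi_cong.
pose add (u v : W) := pi (val u * val v).
have addA : associative add.
  move=> u v w; rewrite /add -[u in LHS]valK -[w in RHS]valK -!piM ?mulgA //; exact: HM.
have addC : commutative add.
  by move=> u v; apply: piE; rewrite /cong (commgCV (val u)) mulgK;
     apply: Kcomm; apply: HV.
have add0 : left_id (pi 1) add.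
  by move=> u; rewrite /add -[u in LHS]valK -piM // mul1g valK.
pose opp (u : W) := pi (val u)^-1.
have addN : left_inverse (pi 1) opp add.
  move=> u; rewrite /add /opp -{2}[u]valK -piM ?mulVg //; exact: HV.
pose V : zmodType := HB.pack W (GRing.isZmodule.Build W addA addC add0 addN).
exists V, pi, val; split=> // x Hx; split; last first.
  by move=> Kx; apply: piE; rewrite /cong invg1 mulg1.
move=> px1; have := pi_cong x Hx; rewrite [pi x]px1 => cx.
by have := congT _ _ _ cx (congV _ _ (pi_cong 1 H1)); rewrite /cong invg1 mulg1.
Qed.

Lemma subgroupX (G : groupType) (H : set G) x n : is_subgroup H -> H x -> H (x ^+ n).
Proof.
move=> [H1 HM _] Hx; elim: n => [|n IH]; first by rewrite expg0.
by rewrite expgS; apply: HM.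
Qed.

Section SubquotientMorphism.
Variables (G : groupType) (H : set G) (V : zmodType) (phi : G -> V).
Hypotheses (sH : is_subgroup H)
  (phiM : forall x y, H x -> H y -> phi (x * y) = (phi x + phi y)%R).

Lemma subquot1 : phi 1 = 0%R.
Proof.
have [H1 _ _] := sH; have /eqP := phiM H1 H1.
by rewrite mulg1 -subr_eq subrr => /eqP.
Qed.

Lemma subquotV x : H x -> phi x^-1 = (- phi x)%R.
Proof.
move=> Hx; apply/esym/addr0_eq; rewrite -phiM ?mulgV ?subquot1 //.
by case: sH => _ _ HV; apply: HV.
Qed.

Lemma subquotF x y : H x -> H y -> phi (x / y) = (phi x - phi y)%R.
Proof. by move=> Hx Hy; rewrite phiM ?subquotV //; case: sH => _ _ HV; apply: HV. Qed.

Lemma subquotX x n : H x -> phi (x ^+ n) = (phi x *+ n)%R.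
Proof.
move=> Hx; elim: n => [|n IH]; first by rewrite expg0 subquot1.
by rewrite expgS mulrS phiM ?IH //; apply: subgroupX.
Qed.

Lemma subquot_preim (W : set V) : zsub W -> is_subgroup [set x | H x /\ W (phi x)].
Proof.
have [H1 HM HV] := sH; move=> sW; split=> [|x y [Hx Wx] [Hy Wy]|x [Hx Wx]].
- by split=> //; rewrite subquot1; apply: sW.1.
- by split; [apply: HM | rewrite phiM //; apply: zsubD].
- by split; [apply: HV | rewrite subquotV //; apply: zsubN].
Qed.

End SubquotientMorphism.

(** * The two layers G/G' and G' *)

Lemma abelianization_reduced (G : groupType) :
  finitely_generated G -> exists B, forall p, (B < p)%N -> prime p ->
    (forall x k, derived_subgroup G (x ^+ (p ^ k)) -> derived_subgroup G x) /\
    (forall x, (forall k, exists y : G, x = y ^+ (p ^ k)) ->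
       exists2 m, (0 < m)%N & derived_subgroup G (x ^+ m)).
Proof.
move=> [s gens]; set D := derived_subgroup G.
have sT : is_subgroup [set: G] by [].
have [||V [phi [rho [_ rhoK phiM phi0]]]] :=
  @abelian_subquotient G setT D sT (generated_subgroup _).
- by [].
- by move=> x y _ _; apply: derived_commg.
(* No operators are needed for G/G', hence the count 0 and a dummy family. *)
have [//|W [SW [sW _] _ redW]] := @tame_span V (fun _ => idfun) 0 [seq phi x | x <- s].
have WT v : W v.
  rewrite -[v]rhoK; apply: (subgroup_eqT gens (subquot_preim sT phiM sW) _ (rho v)).2.
  by move=> x sx; rewrite inE /=; split=> //; apply: SW; apply: map_f.
have [|B HB] := redW [set 0%R].
  by split=> //; split=> // x y -> ->; rewrite subrr.
exists B => p ltBp p_pr; have red := HB p ltBp p_pr.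
split=> [x k /phi0 px|x divx].
  apply/(phi0 x I); apply: (reduced_mod_exp (k := k) sW red) => //=.
  by rewrite -(subquotX sT phiM) //; apply: px.
have [//|k|m m_gt0 pxm] := red.2 (phi x).
  have [y ->] := divx k; exists (phi y) => //=.
  by rewrite (subquotX sT phiM) // subrr.
by exists m => //; apply/(phi0 _ I); rewrite (subquotX sT phiM).
Qed.

(** Since G' acts trivially on itself, conjugations by elements of G commute on G', which is thus a
    module over commuting operators. *)
Lemma derived_reduced (G : groupType) :
  finitely_generated G -> metabelian G -> exists B, forall p, (B < p)%N -> prime p ->
    forall x, derived_subgroup G x ->
    (forall k, exists2 y, derived_subgroup G y & x = y ^+ (p ^ k)) ->
    exists2 m, (0 < m)%N & x ^+ m = 1.
Proof.
move=> [s gens] metG; set D := derived_subgroup G.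
have sD : is_subgroup D := generated_subgroup _.
have [D1 DM DV] := sD.
have DJ x g : D x -> D (x ^ g).
  by move=> Dx; rewrite -[x ^ g](mulVKg x) -commgEl; apply: DM => //;
     apply: derived_commg.
have s1 : is_subgroup [set (1 : G)].
  by split=> // [x y -> ->|x ->]; rewrite ?mulg1 ?invg1.
have [||V [phi [rho [Drho rhoK phiM phi0]]]] := @abelian_subquotient G D [set 1] sD s1.
- by move=> x ->.
- by move=> x y Dx Dy; apply/eqP/commgP/metG.
have phi_inj x y : D x -> D y -> phi x = phi y -> x = y.
  move=> Dx Dy pxy; apply/divg1_eq/(phi0 _ _).1; first by apply: DM => //; apply: DV.
  by rewrite (subquotF sD phiM) // pxy subrr.
have phiK x : D x -> rho (phi x) = x by move=> Dx; apply: phi_inj.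
pose conj g v := phi (rho v ^ g).
have conj_additive g : zmod_morphism (conj g).
  move=> u v; rewrite /conj -(subquotF sD phiM); try exact: DJ.
  congr phi; rewrite -conjVg -conjMg; congr (_ ^ g); apply: phi_inj => //.
    by apply: DM => //; apply: DV.
  by rewrite (subquotF sD phiM) // !rhoK.
(* Inverses are adjoined so that [W] is closed under conjugation both ways. *)
pose t := s ++ [seq g^-1 | g <- s].
(* Beyond the list, the default 1 gives conjugation by 1, so commutation holds for all indices. *)
pose T i : {additive V -> V} :=
  HB.pack (conj (nth 1 t i))
    (GRing.isZmodMorphism.Build V V _ (conj_additive (nth 1 t i))).
have TC i j v : T i (T j v) = T j (T i v).
  rewrite /= /conj; set a := nth _ _ i; set b := nth _ _ j.
  rewrite !phiK; try exact: DJ.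
  (* The two orders of conjugation differ by [b, a], which lies in G' and so centralizes it. *)
  congr phi; rewrite -!conjgM (commgC b a) conjgM; apply/conjg_fixP/commgP/metG.
    exact: DJ.
  exact: derived_commg.
have [W [SW [sW TW] _ redW]] :=
  tame_span (size t) [seq phi [~ g, h] | g <- s, h <- s] TC.
have WD x : D x -> W (phi x).
  suff DY : D `<=` [set x | D x /\ W (phi x)] by move=> /DY[].
  have Tt g y : g \in t -> D y -> W (phi y) -> W (phi (y ^ g)).
    move=> tg Dy Wy; have := TW (index g t) (phi y); rewrite index_mem => /(_ tg Wy).
    by rewrite /= /conj nth_index // phiK.
  apply: (derived_sub_conj_closed gens (subquot_preim sD phiM sW)).
    move=> g y sg [Dy Wy]; split; (split; first exact: DJ); apply: Tt => //.
      by rewrite mem_cat sg.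
    by rewrite mem_cat map_f ?orbT.
  move=> g h sg sh; split; first exact: derived_commg.
  by apply: SW; apply: allpairs_f.
have [|B HB] := redW [set 0%R].
  by split=> [|i x _ ->]; [split=> // x y -> ->; rewrite subrr | exact: raddf0 (T i)].
exists B => p ltBp p_pr x Dx divx; have red := HB p ltBp p_pr.
have [||m m_gt0 pxm] := red.2 (phi x); first exact: WD.
  move=> k; have [y Dy ->] := divx k; exists (phi y); first exact: WD.
  by rewrite /= (subquotX sD phiM) // subrr.
exists m => //; apply: (phi0 _ (subgroupX m sD Dx)).1.
by rewrite (subquotX sD phiM).
Qed.

(** * Roots in an embedded copy of Q *)

Theorem proposition2 (G : groupType) (hfg : finitely_generated G)
    (hmet : metabelian G) :
  ~ (exists f : rat -> G,
       (forall x y : rat, f (x + y)%R = (f x * f y)%g) /\ injective f).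
Proof.
move=> [f [fM f_inj]].
have f0 : f 0%R = 1 by apply: (mulgI (f 0%R)); rewrite -fM addr0 mulg1.
have fX q n : f (q *+ n)%R = f q ^+ n.
  by elim: n => [|n IH]; rewrite ?mulr0n ?expg0 // mulrS expgS fM IH.
have [B1 ab_red] := abelianization_reduced hfg.
have [B2 der_red] := derived_reduced hfg hmet.
have [p] := prime_above (maxn B1 B2); rewrite gtn_max => /andP[ltB1 ltB2] p_pr.
have [tf dv] := ab_red p ltB1 p_pr.
have root q k : f q = f (q / (p ^ k)%:R)%R ^+ (p ^ k).
  rewrite -fX -[(_ *+ _)%R in RHS]mulr_natr divfK //
    pnatr_eq0 -lt0n expn_gt0 prime_gt0 //.
(* [f 1] has all p^k-th roots, so some positive multiple m of 1 is sent into G'. *)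
have [|m m_gt0] := dv (f 1%R); first by move=> k; exists (f (1 / (p ^ k)%:R)%R).
rewrite -fX => Dm.
have [k|n n_gt0] := der_red p ltB2 p_pr _ Dm.
  (* The root lies in G' because its p^k-th power does and G/G' has no p-torsion. *)
  exists (f ((1 *+ m) / (p ^ k)%:R)%R) => //; apply: (tf _ k); rewrite -root //.
rewrite -fX -f0 => /f_inj /eqP; rewrite -mulrnA pnatr_eq0 muln_eq0.
by rewrite -!leqn0 leqNgt m_gt0 leqNgt n_gt0.
Qed.
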